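(* Let $p_i=p$ for all $i\in U$, where $|U|=n$ and $p=p(n)$ is a function of $n$ such that $\lim_{n\to\infty}p=1$ and $\lim_{n\to\infty}p^n=0$. Moreover, assume $p=1-\frac1{t_n}$, where $t_n$ is an increasing function of $n$ with $t_n=o(n)$. Then the greedy matching algorithm GM is a $\left(\frac{3(e-1)}{16e^2}-\Theta\left(\frac1{t_n}\right)\right)$-approximation for MaxOHP. That is, there is a function $\varepsilon(n)=\Theta(1/t_n)$, not depending on the instance, such that for all sufficiently large $n$, every $n$-element set $U$, every metric $d$ on $U$, and every ordering $O$ of $U$ output by GM, $$\mathcal{H}(O)\ \ge\ \Big(\tfrac{3(e-1)}{16e^2}-\varepsilon(n)\Big)\max_{O'}\mathcal{H}(O'),$$ the maximum being over all orderings $O'$ of $U$.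
   Context: For an ordering $O=(\pi(1),\dots,\pi(n))$ of $U$ with all continuation probabilities equal to $p$, the ordered Hamiltonian path objective is $\mathcal{H}(O)=\sum_{i=1}^{n-1}\big(\sum_{j=i+1}^np^j\big)d(\pi(i),\pi(i+1))$; MaxOHP asks to maximize $\mathcal{H}(O)$ over all orderings. Algorithm GM. Let $k=\lfloor n/2\rfloor$. Process all pairs $\{u,v\}$ of distinct items in non-increasing order of $d(u,v)$ (ties broken arbitrarily), adding a pair to $M$ whenever it is disjoint from all pairs already in $M$; this produces a matching $M=((u_1,v_1),(u_3,v_3),\dots,(u_{2k-1},v_{2k-1}))$ listed in the order of selection. The ordering $\pi$ is built from the end: if $n=2k+1$, let $\pi(2k+1)$ be the unique unmatched item. Then for $i=k,k-1,\dots,1$: if $i=k$ and $n=2k$, set $\pi(2k-1)=v_{2k-1}$ and $\pi(2k)=u_{2k-1}$; otherwise, if $d(v_{2i-1},\pi(2i+1))\ge d(u_{2i-1},\pi(2i+1))$ set $\pi(2i-1)=u_{2i-1}$, $\pi(2i)=v_{2i-1}$, else set $\pi(2i-1)=v_{2i-1}$, $\pi(2i)=u_{2i-1}$. Output $O=(\pi(1),\dots,\pi(n))$. *)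

(* Defs.v *)
From HB Require Import structures.
From mathcomp Require Import all_boot all_order all_algebra.
From mathcomp Require Import all_classical all_reals all_analysis.

Set Implicit Arguments.
Unset Strict Implicit.
Unset Printing Implicit Defensive.

Import Order.TTheory GRing.Theory Num.Theory.
Import numFieldNormedType.Exports.

Local Open Scope ring_scope.

(* Same axioms as the factory [isMetric], as a predicate on a function [d], so
   that [d] can vary over a fixed finite type. Nonnegativity of [d] follows. *)
Record is_metric (R : realType) (U : finType) (d : U -> U -> R) : Prop := IsMetric {
  metric_eq0 : forall x y, d x y = 0 <-> x = y;
  metric_sym : forall x y, d x y = d y x;
  metric_triangle : forall x y z, d x z <= d x y + d y z
}.

(* An ordering of U is a sequence listing every item of U exactly once.
   The sums are 1-indexed: the i-th item of the ordering O is [nth x0 O i.-1].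
   The head x0 of O serves only as the default value of [nth]. *)
Definition ohp_objective (R : realType) (U : finType) (p : R) (d : U -> U -> R)
    (O : seq U) : R :=
  if O is x0 :: _ then
    \sum_(1 <= i < size O)
      (\sum_(i.+1 <= j < (size O).+1) p ^+ j) * d (nth x0 O i.-1) (nth x0 O i)
  else 0.

(* The initial value 0 of the maximum is harmless: the objective is nonnegative
   as soon as 0 <= p and d is a metric, and [permutations (enum U)], the list of
   all orderings of U, is never empty. *)
Definition max_ohp (R : realType) (U : finType) (p : R) (d : U -> U -> R) : R :=
  \big[Num.max/0]_(O <- permutations (enum U)) ohp_objective p d O.

(* An unordered pair {u, v} is represented by (u, v) or (v, u). *)
Definition pair_set (U : finType) (e : U * U) : {set U} := [set e.1; e.2].

(* E lists every 2-element subset of U exactly once, in non-increasing order of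
   distance. Both the order among ties and the choice of which endpoint of each
   pair is written first are arbitrary. *)
Definition processing_order (R : realType) (U : finType) (d : U -> U -> R)
    (E : seq (U * U)) : Prop :=
  perm_eq (map (@pair_set U) E) (enum [set A : {set U} | #|A| == 2%N]) /\
  sorted (fun e f : U * U => d f.1 f.2 <= d e.1 e.2) E.

Definition greedy_matching (U : finType) (E : seq (U * U)) : seq (U * U) :=
  foldl (fun M e =>
           if all (fun f => [disjoint pair_set f & pair_set e]) M
           then rcons M e else M)
        [::] E.

(* For a greedy matching this has one element if #|U| is odd, none if even. *)
Definition unmatched (U : finType) (M : seq (U * U)) : seq U :=
  [seq x <- enum U | all (fun e => x \notin pair_set e) M].

(* Puts the pair e = (u, v) in front of the part s of the ordering built so far;
   s is empty only for the last pair of M when #|U| is even. *)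
Definition gm_step (R : realType) (U : finType) (d : U -> U -> R)
    (e : U * U) (s : seq U) : seq U :=
  let: (u, v) := e in
  if s is x :: _ then
    if d u x <= d v x then [:: u, v & s] else [:: v, u & s]
  else [:: v; u].

Definition gm_ordering (R : realType) (U : finType) (d : U -> U -> R)
    (M : seq (U * U)) : seq U :=
  foldr (gm_step d) (unmatched M) M.

Definition gm_output (R : realType) (U : finType) (d : U -> U -> R)
    (O : seq U) : Prop :=
  exists2 E, processing_order d E & O = gm_ordering d (greedy_matching E).

(* Main.v *)
(* For every n and every p in [0, 1], GM is in fact a 1/4-approximation, and
   3(e-1)/(16e^2) <= 1/4, so eps = 1/t works.  Exchanging the two sums, the
   objective is the sum over j of p^(j+1) times the length of the first j edges,
   so it suffices to compare these prefix lengths.  Let m_1 >= m_2 >= ... be the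
   lengths of the greedy pairs.  The first j edges of GM's ordering contain the
   first ceil(j/2) greedy pairs.  Conversely, a pair {x, y} meets a greedy pair at
   least as long, so d(x, y) is at most the sum of the lengths of the greedy pairs
   containing x and y; since each greedy pair covers only two items, any j
   distinct items collect at most 2(m_1 + ... + m_ceil(j/2)), and the j left and
   the j right endpoints of the first j edges of any ordering together at most
   twice that. *)
Require Import Defs.
From HB Require Import structures.
From mathcomp Require Import all_boot all_order all_algebra.
From mathcomp Require Import all_classical all_reals all_analysis.
From mathcomp Require Import zify lra.
Import Order.TTheory GRing.Theory Num.Theory.
Import numFieldNormedType.Exports.
Local Open Scope ring_scope.

Set Implicit Arguments.
Unset Strict Implicit.

(** * Exchange of sums and a weighted sum under a budget *)

Lemma sum_tail_prefix (R : pzSemiRingType) (a f : nat -> R) n :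
  \sum_(1 <= i < n) (\sum_(i.+1 <= j < n.+1) a j) * f i.-1 =
  \sum_(j < n.-1) a j.+2 * \sum_(i < j.+1) f i.
Proof.
case: n => [|n]; first by rewrite big_geq // big_ord0.
rewrite big_add1 big_mkord /=; elim: n => [|n IH]; first by rewrite !big_ord0.
rewrite !big_ord_recr /= -IH big_nat1 mulrDr addrA.
congr (_ + _); rewrite mulr_sumr -big_split /=.
by apply: eq_bigr => i _; rewrite big_nat_recr 1?mulrDl //= !ltnS ltnW.
Qed.

(** Since [a] is nonincreasing, a budget of [2 * h] units, at most 2 per index, is best spent on the
    first [h] indices. *)
Lemma sum_capped_le (R : realDomainType) (a : nat -> R) (c : nat -> nat) k h :
  (forall l, 0 <= a l) -> (forall l, a l.+1 <= a l) ->
  (forall l, (c l <= 2)%N) -> (\sum_(l < k) c l <= 2 * h)%N ->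
  \sum_(l < k) a l * (c l)%:R <= 2 * \sum_(l < h) a l.
Proof.
move=> a0 adec c2 csum.
have anti : {homo a : x y / (x <= y)%N >-> y <= x}.
  by apply: homo_leq => // x y z yx zy; exact: le_trans zy yx.
have cR l : (c l)%:R <= 2 :> R by rewrite ler_nat.
have [hk|kh] := leqP h k; last first.
  rewrite -(subnKC (ltnW kh)) big_split_ord /= mulrDr -[leLHS]addr0 lerD //.
    by rewrite mulr_sumr ler_sum // => l _; have := a0 l; have := cR l; nra.
  by rewrite mulr_ge0 // sumr_ge0.
have csumR : \sum_(l < k) (c l)%:R <= 2 * h%:R :> R.
  by rewrite -natr_sum -natrM ler_nat.
move: hk csumR => /subnKC <-; rewrite !big_split_ord /=; set m := (k - h)%N => csumR.
(* The threshold is [a h]: for [l < h], [(a l - a h) * (c l - 2) <= 0]. With [high], the terms in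
   [a h] add up to [a h] times total minus budget, which is at most 0. *)
have low : \sum_(l < h) a l * (c l)%:R <= \sum_(l < h) (2 * a l + a h * ((c l)%:R - 2)).
  apply: ler_sum => l _; have := cR l; have := anti _ _ (ltnW (ltn_ord l)); nra.
have high : \sum_(l < m) a (h + l)%N * (c (h + l)%N)%:R <= a h * \sum_(l < m) (c (h + l)%N)%:R.
  rewrite mulr_sumr ler_sum // => l _; rewrite ler_wpM2r //; exact/anti/leq_addr.
move: low high csumR; rewrite big_split /= -!mulr_sumr sumrB sumr_const card_ord.
have := a0 h; rewrite -mulr_natr; nra.
Qed.

(** * Matchings and prefix lengths of orderings *)

Definition pair_length (R : realType) (U : finType) (d : U -> U -> R) (e : U * U) : R :=
  d e.1 e.2.

Definition pair_lengths (R : realType) (U : finType) (d : U -> U -> R)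
    (M : seq (U * U)) : seq R := map (pair_length d) M.

(** [uniq (endpoints M)] expresses that [M] is a matching of nondegenerate pairs. *)
Definition endpoints (U : finType) (M : seq (U * U)) : seq U :=
  flatten [seq [:: e.1; e.2] | e <- M].

Definition path_length (R : realType) (U : finType) (d : U -> U -> R) (x0 : U)
    (s : seq U) (j : nat) : R := \sum_(i < j) d (nth x0 s i) (nth x0 s i.+1).

(** In a matching, this is the length of the pair containing [x], or 0 if [x] is unmatched. The form
    as a sum over pairs allows exchanging it with sums over items. *)
Definition matched_length (R : realType) (U : finType) (d : U -> U -> R)
    (M : seq (U * U)) (x : U) : R :=
  \sum_(e <- M) pair_length d e * ((e.1 == x) + (e.2 == x))%:R.

Lemma metric_ge0 (R : realType) (U : finType) (d : U -> U -> R) x y :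
  is_metric d -> 0 <= d x y.
Proof.
move=> [d0 dC dT]; have := dT x y x; rewrite [d y x]dC.
by have /d0 -> : x = x by []; lra.
Qed.

Lemma ohp_objectiveE (R : realType) (U : finType) (p : R) (d : U -> U -> R) x0 O :
  ohp_objective p d O =
  \sum_(j < (size O).-1) p ^+ j.+2 * path_length d x0 O j.+1.
Proof.
case: O => [|x O]; first by rewrite big_ord0.
rewrite /path_length -(sum_tail_prefix (fun j => p ^+ j)
  (fun i => d (nth x0 (x :: O) i) (nth x0 (x :: O) i.+1))) /ohp_objective.
rewrite !big_nat; apply: eq_bigr => i /andP[i1 iO]; rewrite prednK //.
by rewrite !(set_nth_default x0 x) // (leq_ltn_trans (leq_pred _)).
Qed.

Lemma endpoints_rcons (U : finType) (M : seq (U * U)) e :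
  endpoints (rcons M e) = endpoints M ++ [:: e.1; e.2].
Proof. by rewrite /endpoints map_rcons flatten_rcons. Qed.

Lemma mem_endpoints (U : finType) (M : seq (U * U)) x :
  (x \in endpoints M) = has (fun e => x \in pair_set e) M.
Proof. by elim: M => //= e M IH; rewrite !inE IH orbA. Qed.

(** * The greedy matching *)

Lemma greedy_matching_rcons (U : finType) (E : seq (U * U)) e :
  greedy_matching (rcons E e) =
  if all (fun f => [disjoint pair_set f & pair_set e]) (greedy_matching E)
  then rcons (greedy_matching E) e else greedy_matching E.
Proof. by rewrite /greedy_matching foldl_rcons. Qed.

Lemma greedy_matching_subseq (U : finType) (E : seq (U * U)) :
  subseq (greedy_matching E) E.
Proof.
elim/last_ind: E => // E e IH; rewrite greedy_matching_rcons.
case: ifP => _; first by rewrite -!cats1 cat_subseq.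
exact: subseq_trans IH (subseq_rcons _ _).
Qed.

Lemma disjoint_endpoints (U : finType) (M : seq (U * U)) (e : U * U) (x : U) :
  all (fun f => [disjoint pair_set f & pair_set e]) M ->
  x \in pair_set e -> x \notin endpoints M.
Proof.
move=> /allP disj xe; rewrite mem_endpoints; apply/hasPn => f /disj.
by move=> /disjointFl -> .
Qed.

Lemma uniq_greedy_endpoints (U : finType) (E : seq (U * U)) :
  {in E, forall e, e.1 != e.2} -> uniq (endpoints (greedy_matching E)).
Proof.
elim/last_ind: E => // E e IH eneq; rewrite greedy_matching_rcons.
have {}IH : uniq (endpoints (greedy_matching E)).
  by apply: IH => f fE; apply: eneq; rewrite mem_rcons inE fE orbT.
case: ifP => // disj; rewrite endpoints_rcons cat_uniq IH /= !inE orbF.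
by rewrite !(negPf (disjoint_endpoints disj _)) ?eneq ?mem_rcons ?inE ?eqxx ?orbT.
Qed.

(** A selected pair blocks itself; a rejected one meets a pair selected earlier, hence at least as
    long. *)
Lemma greedy_matching_blocks (R : realType) (U : finType) (d : U -> U -> R)
    (E : seq (U * U)) (e : U * U) :
  sorted (fun e f => pair_length d f <= pair_length d e) E -> e \in E ->
  exists2 f, f \in greedy_matching E &
    ~~ [disjoint pair_set f & pair_set e] /\ pair_length d e <= pair_length d f.
Proof.
rewrite sorted_pairwise; last by move=> y x z yx zy; exact: le_trans zy yx.
elim/last_ind: E e => // E e0 IH e; rewrite pairwise_rcons => /andP[/allP small srt].
rewrite greedy_matching_rcons mem_rcons inE => /predU1P[->{e}|eE].
  case: ifPn => [_|/allPn[f fM fe]].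
    exists e0; first by rewrite mem_rcons mem_head.
    by split=> //; apply/pred0Pn; exists e0.1; rewrite /= !inE eqxx.
  by exists f => //; split=> //; apply: small; exact: mem_subseq (greedy_matching_subseq E) _ fM.
have [f fM fe] := IH _ srt eE; exists f => //.
by case: ifP => _ //; rewrite mem_rcons inE fM orbT.
Qed.

(** * The GM ordering: size and lower bound on prefixes *)

Lemma size_gm_step (R : realType) (U : finType) (d : U -> U -> R) e s :
  size (gm_step d e s) = (size s).+2.
Proof. by case: e s => u v [|x s] //=; case: ifP. Qed.

(** Each step adds two items to the unmatched ones. The size makes the objectives of GM and of any
    ordering sums over the same range. *)
Lemma size_gm_ordering (R : realType) (U : finType) (d : U -> U -> R) M :
  uniq (endpoints M) -> size (gm_ordering d M) = #|U|.
Proof.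
move=> uM; have sizeE (s : seq U) :
    size (foldr (gm_step d) s M) = (size s + size (endpoints M))%N.
  elim: {uM}M => [|e M IH]; first by rewrite addn0.
  by apply: etrans (size_gm_step d e _) _; rewrite IH !addnS.
rewrite /gm_ordering sizeE -(card_uniqP uM) [RHS]cardE.
rewrite -(count_predC (mem (endpoints M)) (enum U)) addnC.
congr (_ + _)%N; first by rewrite cardE enumT -size_filter.
rewrite size_filter; apply: eq_count => x /=.
by rewrite mem_endpoints -all_predC.
Qed.

(* Edges 1, 3, 5, ... of the ordering are the matched pairs; the others are
   bounded below by 0. *)
Lemma gm_path_length_ge (R : realType) (U : finType) (d : U -> U -> R) x0
    (s : seq U) (M : seq (U * U)) j :
  is_metric d ->
  \sum_(l < uphalf j) (pair_lengths d M)`_l <=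
  path_length d x0 (foldr (gm_step d) s M) j.
Proof.
move=> dm; have d_ge0 x y : 0 <= d x y by exact: metric_ge0.
have len_ge0 s' i : 0 <= path_length d x0 s' i by exact: sumr_ge0.
elim: M j => [|e M IH] j.
  by rewrite big1 // => l _; rewrite nth_nil.
have -> : foldr (gm_step d) s (e :: M) = gm_step d e (foldr (gm_step d) s M) by [].
move: (foldr _ s M) IH => s' IH.
have [u [v [-> duv]]] : exists u v, gm_step d e s' = [:: u, v & s'] /\
    d u v = pair_length d e.
  rewrite /pair_length; case: e => u v; case: (s') => [|x s''] /=.
    by exists v, u; split=> //; case: dm.
  by case: ifP => _; [exists u, v | exists v, u]; split=> //; case: dm.
case: j => [|[|j]]; first by rewrite /path_length !big_ord0.
  by rewrite /path_length !big_ord1 /= duv.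
(* Two edges consume one pair. Past the end of the ordering [nth] returns [x0], and the distances
   stay nonnegative. *)
rewrite /path_length !big_ord_recl /= duv lerD2l.
rewrite (le_trans (IH j)) // /path_length -[leLHS]add0r lerD //.
Qed.

(** * Upper bound on prefixes of any ordering *)

Lemma matched_length_sum (R : realType) (U : finType) (d : U -> U -> R)
    (M : seq (U * U)) (s : seq U) h :
  is_metric d -> sorted (fun e f => pair_length d f <= pair_length d e) M ->
  uniq (endpoints M) -> uniq s -> (size s <= 2 * h)%N ->
  \sum_(x <- s) matched_length d M x <= 2 * \sum_(l < h) (pair_lengths d M)`_l.
Proof.
move=> dm srt uM us sh.
(* The default 0 of [nth] keeps the sequence nonnegative and nonincreasing beyond the last pair. *)
have a0 l : 0 <= (pair_lengths d M)`_l.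
  have [lM|Ml] := ltnP l (size (pair_lengths d M)); last by rewrite nth_default.
  by have /mapP[e _ ->] := mem_nth 0 lM; exact: metric_ge0.
have adec l : (pair_lengths d M)`_l.+1 <= (pair_lengths d M)`_l.
  have [lM|Ml] := ltnP l.+1 (size (pair_lengths d M)); last by rewrite nth_default.
  have /(sortedP 0) : sorted (fun x y : R => y <= x) (pair_lengths d M).
    by rewrite sorted_map.
  exact.
rewrite exchange_big /=.
(* How often the length of [e] is collected along [s]: at most twice. *)
pose c (e : U * U) : nat := ((e.1 \in s) + (e.2 \in s))%N.
have -> : \sum_(e <- M) \sum_(x <- s) pair_length d e * ((e.1 == x) + (e.2 == x))%:R
    = \sum_(e <- M) pair_length d e * (c e)%:R.
  apply: eq_bigr => e _; rewrite -mulr_sumr -natr_sum big_split /= /c.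
  have cnt y : (\sum_(x <- s) (y == x) = (y \in s))%N.
    rewrite -(count_uniq_mem _ us) -sum1_count [RHS]big_mkcond /=.
    by apply: eq_bigr => x _; rewrite eq_sym; case: eqP.
  by rewrite !cnt.
have -> : \sum_(e <- M) pair_length d e * (c e)%:R
    = \sum_(l < size M) (pair_lengths d M)`_l * (nth 0%N (map c M) l)%:R.
  rewrite -(big_mkord xpredT (fun l => (pair_lengths d M)`_l * (nth 0%N (map c M) l)%:R)).
  elim: (M) => [|e M' IH]; first by rewrite big_nil big_geq.
  by rewrite big_cons big_nat_recl //= IH.
apply: sum_capped_le => //.
- move=> l; have [lM|Ml] := ltnP l (size (map c M)); last by rewrite nth_default.
  by have /mapP[e _ ->] := mem_nth 0%N lM; rewrite /c; do 2 case: (_ \in _).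
(* The total count is at most [size s], because the endpoints of [M] are distinct. *)
have -> : (\sum_(l < size M) nth 0 (map c M) l = count (mem s) (endpoints M))%N.
  rewrite -(big_mkord xpredT (fun l => nth 0%N (map c M) l)).
  elim: (M) => [|e M' IH]; first by rewrite big_geq.
  by rewrite big_nat_recl //= IH addnA.
apply: leq_trans sh; rewrite -size_filter uniq_leq_size ?filter_uniq // => x.
by rewrite mem_filter => /andP[].
Qed.

Lemma processing_order_neq (R : realType) (U : finType) (d : U -> U -> R) E :
  processing_order d E -> {in E, forall e, e.1 != e.2}.
Proof.
move=> [permE _] e /(map_f (@pair_set U)); rewrite (perm_mem permE) mem_enum inE.
by rewrite /pair_set cards2; case: (e.1 != e.2).
Qed.

Lemma dist_le_matched_length (R : realType) (U : finType) (d : U -> U -> R) E x y :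
  is_metric d -> processing_order d E -> x != y ->
  d x y <= matched_length d (greedy_matching E) x +
           matched_length d (greedy_matching E) y.
Proof.
move=> dm [permE srt] xy; set M := greedy_matching E.
have len_ge0 e : 0 <= pair_length d e by exact: metric_ge0.
have mu_ge0 z : 0 <= matched_length d M z.
  by apply: sumr_ge0 => e _; rewrite mulr_ge0.
have mu_ge f z : f \in M -> z \in pair_set f -> pair_length d f <= matched_length d M z.
  move=> fM zf; rewrite /matched_length (big_rem f) //=.
  rewrite -[leLHS]addr0 lerD ?sumr_ge0 // => [|e _]; last by rewrite mulr_ge0.
  rewrite ler_peMr // ler1n addn_gt0 !lt0b.
  by move: zf; rewrite !inE ![z == _]eq_sym.
have : [set x; y]%SET \in map (@pair_set U) E.
  by rewrite (perm_mem permE) mem_enum inE cards2 xy.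
move=> /mapP[e eE exy].
have dxy : d x y = pair_length d e.
  have : (x \in pair_set e) && (y \in pair_set e) by rewrite -exy !inE !eqxx orbT.
  rewrite !inE /pair_length; case: dm => _ dC _.
  move: xy => /[swap] /andP[/orP[]/eqP-> /orP[]/eqP->]; rewrite ?eqxx //.
(* The blocking pair [f] shares an item [z] with [{x, y}], so the matched length of [x] or of [y]
   already dominates. *)
have [f fM [/pred0Pn[z /andP[/= zf ze]] ef]] := greedy_matching_blocks srt eE.
rewrite dxy (le_trans ef) // (le_trans (mu_ge f z fM zf)) //.
by move: ze; rewrite -exy !inE => /orP[]/eqP->; rewrite ?lerDl ?lerDr.
Qed.

(* Each of the j edges is charged to the matched lengths of its two endpoints;
   the left endpoints and the right endpoints are j distinct items each. *)
Lemma path_length_le (R : realType) (U : finType) (d : U -> U -> R) x0 E s j :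
  is_metric d -> processing_order d E -> uniq s -> (j < size s)%N ->
  path_length d x0 s j <=
  4 * \sum_(l < uphalf j) (pair_lengths d (greedy_matching E))`_l.
Proof.
move=> dm Eord us js; set mu := matched_length d (greedy_matching E).
have sumE s' : (j <= size s')%N ->
    \sum_(i < j) mu (nth x0 s' i) = \sum_(x <- take j s') mu x.
  move=> js'; rewrite (big_nth x0) size_takel // big_mkord.
  by apply: eq_bigr => i _; rewrite nth_take.
have bound s' : uniq s' -> (j <= size s')%N -> \sum_(i < j) mu (nth x0 s' i) <=
    2 * \sum_(l < uphalf j) (pair_lengths d (greedy_matching E))`_l.
  move=> us' js'; rewrite sumE //; apply: matched_length_sum => //.
  - case: Eord => _; apply: subseq_sorted (greedy_matching_subseq E).
    by move=> b a c ba cb; exact: le_trans cb ba.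
  - exact/uniq_greedy_endpoints/processing_order_neq/Eord.
  - exact: take_uniq.
  - by rewrite size_takel //; lia.
have left := bound s us (ltnW js).
(* The right endpoints are the first [j] items of [behead s], which has enough items since
   [j < size s]. *)
have right : \sum_(i < j) mu (nth x0 (behead s) i) <=
    2 * \sum_(l < uphalf j) (pair_lengths d (greedy_matching E))`_l.
  apply: bound; first by rewrite -drop1 drop_uniq.
  by rewrite size_behead; lia.
apply: le_trans (_ : \sum_(i < j) (mu (nth x0 s i) + mu (nth x0 (behead s) i)) <= _).
  apply: ler_sum => i _; rewrite nth_behead dist_le_matched_length //.
  have iS : (i.+1 < size s)%N by exact: leq_ltn_trans (ltn_ord i) js.
  by rewrite nth_uniq ?neq_ltn ?ltnSn // ltnW.
by rewrite big_split /=; lra.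
Qed.

(** * Comparison of objectives *)

Lemma ohp_objective_ge0 (R : realType) (U : finType) (p : R) (d : U -> U -> R) (x0 : U) O :
  0 <= p -> is_metric d -> 0 <= ohp_objective p d O.
Proof.
move=> p0 dm; rewrite (ohp_objectiveE _ _ x0) sumr_ge0 // => j _.
by rewrite mulr_ge0 ?exprn_ge0 // sumr_ge0 // => i _; exact: metric_ge0.
Qed.

(** For each prefix, the upper bound for any ordering is 4 times the lower bound for GM, so the
    objectives compare term by term. *)
Lemma gm_output_quarter (R : realType) (U : finType) (p : R) (d : U -> U -> R) (x0 : U) O :
  0 <= p -> is_metric d -> gm_output d O ->
  max_ohp p d <= 4 * ohp_objective p d O.
Proof.
move=> p0 dm [E Eord ->]; set M := greedy_matching E.
have sizeM := size_gm_ordering d (uniq_greedy_endpoints (processing_order_neq Eord)).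
rewrite /max_ohp big_seq; apply: bigmax_le => [|O']; first by rewrite mulr_ge0 ?ohp_objective_ge0.
rewrite mem_permutations => permO'.
have uO' : uniq O' by rewrite (perm_uniq permO') enum_uniq.
have sO' : size O' = #|U| by rewrite (perm_size permO') cardE.
rewrite !(ohp_objectiveE _ _ x0) sizeM sO' mulr_sumr ler_sum // => j _.
rewrite mulrCA ler_wpM2l ?exprn_ge0 //.
apply: le_trans (path_length_le x0 dm Eord uO' _) _; first by have := ltn_ord j; lia.
by rewrite ler_wpM2l // gm_path_length_ge.
Qed.

Local Open Scope classical_set_scope.
Local Open Scope ring_scope.

Theorem theorem6p2 (R : realType) (p t : nat -> R)
    (p_prob : forall n : nat, 0 <= p n <= 1)
    (p_cvg1 : p n @[n --> \oo] --> (1 : R))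
    (pn_cvg0 : p n ^+ n @[n --> \oo] --> (0 : R))
    (p_t : forall n : nat, p n = 1 - 1 / t n)
    (t_incr : nondecreasing_seq t)
    (t_littleo : t =o_\oo (fun n : nat => n%:R : R)) :
  exists eps : nat -> R,
    [/\ eps =Theta_\oo (fun n : nat => 1 / t n),
        \forall n \near \oo, 0 <= eps n
      & \forall n \near \oo,
          forall (U : finType) (d : U -> U -> R) (O : seq U),
            #|U| = n -> is_metric d -> gm_output d O ->
            ohp_objective (p n) d O >=
              (3 * (expR 1 - 1) / (16 * expR 1 ^+ 2) - eps n)
              * max_ohp (p n) d].
Proof.
(* Here [1 / t n = 1 - p n]. *)
have eps_ge0 n : 0 <= 1 / t n by have := p_t n; have := p_prob n; lra.
exists (fun n => 1 / t n); split; [exact: idTheta | exact: nearW |].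
near=> n => U d O Un dm gmO.
have /andP[pn_ge0 _] := p_prob n.
have /card_gt0P[x0 _] : (0 < #|U|)%N by rewrite Un; near: n; exact: nbhs_infty_gt.
have quarter := gm_output_quarter x0 pn_ge0 dm gmO.
have max_ge0 : 0 <= max_ohp (p n) d by exact: bigmax_ge_id.
(* Amounts to [3 * (e - 1) <= 4 * e ^ 2], a quadratic in [e] with negative discriminant. *)
have const_le : 3 * (expR 1 - 1) / (16 * expR 1 ^+ 2) <= 4^-1 :> R.
  have e_gt0 : 0 < expR 1 :> R by exact: expR_gt0.
  by rewrite ler_pdivrMr ?mulr_gt0 ?exprn_gt0 //; nra.
apply: le_trans (_ : 4^-1 * max_ohp (p n) d <= _); last by lra.
by rewrite ler_wpM2r //; have := eps_ge0 n; lra.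
Unshelve. all: by end_near.
Qed.
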